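(* Let $D$ be a (finite) digraph. Then $D$ has a strong in-domatic partition if and only if $D$ is strong.
   Context: All digraphs are finite, loopless, without parallel arcs. A digraph is strong if for every pair of vertices $u,v$ there is a directed $uv$-walk and a directed $vu$-walk (a one-vertex digraph is strong). For $S\subseteq V(D)$, $D\langle S\rangle$ is the subdigraph induced by $S$. A set $S\subseteq V(D)$ is in-dominating if every vertex $x\in V(D)\setminus S$ has an out-neighbor in $S$, i.e. there is $z\in S$ with $(x,z)\in A(D)$. $S$ is a strong in-dominating set if it is in-dominating and $D\langle S\rangle$ is strong. A strong in-domatic partition of $D$ is a partition of $V(D)$ into strong in-dominating sets. *)

(* Defs.v *)
From mathcomp Require Import all_boot.

Set Implicit Arguments.
Unset Strict Implicit.
Unset Printing Implicit Defensive.

(* Encoding arcs as a boolean relation rules out parallel arcs (opposite arcs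
   remain allowed).  The vertex set may be empty. *)
Record digraph := Digraph {
  vertex :> finType;
  arc : rel vertex;
  arc_irreflexive : irreflexive arc
}.

(* The walk u = x_0, x_1, ..., x_k = v is given by p = [:: x_1; ...; x_k];
   p = [::] is the trivial walk from u to itself. *)
Definition walk (D : digraph) (u v : D) (p : seq D) : Prop :=
  path (@arc D) u p /\ last u p = v.

Definition strong (D : digraph) : Prop :=
  forall u v : D, (exists p, walk u v p) /\ (exists p, walk v u p).

Section Induced.
Variables (D : digraph) (S : {set D}).

Definition induced_arc : rel {x : D | x \in S} :=
  fun x y => arc (val x) (val y).

Lemma induced_arc_irreflexive : irreflexive induced_arc.
Proof. by move=> x; exact: arc_irreflexive. Qed.

Definition induced : digraph := Digraph induced_arc_irreflexive.

End Induced.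

Definition in_dominating (D : digraph) (S : {set D}) : Prop :=
  forall x : D, x \notin S -> exists2 z : D, z \in S & arc x z.

Definition strong_in_dominating (D : digraph) (S : {set D}) : Prop :=
  in_dominating S /\ strong (induced S).

(* [partition] requires the blocks to be nonempty. *)
Definition strong_in_domatic_partition (D : digraph) (P : {set {set D}}) : Prop :=
  partition P [set: D] /\ forall S, S \in P -> strong_in_dominating S.

(* Main.v *)
(* For the converse, in-domination lets every vertex u enter the block of v by
   one arc, and that block is strong; so u reaches v. *)
Require Import Defs.
From mathcomp Require Import all_boot.

(** For a strong digraph one block suffices: the full vertex set dominates vacuously and induces a
    copy of [D] ([strong_induced_setT]). Conversely, [strong_in_dominating_walk] joins any vertex to
    any member of a block, and the blocks cover [D]. *)

Lemma strongP (D : digraph) :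
  strong D <-> forall u v : D, exists p, walk u v p.
Proof. by split=> [sD u v | wD u v]; [case: (sD u v) | split]. Qed.

Lemma strong_induced_setT (D : digraph) :
  strong D -> strong (induced [set: D]).
Proof.
move=> /strongP sD; apply/strongP => u v.
have [p [up lp]] := sD (val u) (val v).
pose f (x : D) : induced [set: D] := exist _ x (in_setT x).
have fK : cancel val f by move=> x; apply: val_inj.
(* With [u] written as [f (val u)], the whole walk is an image under [f]. *)
exists (map f p); rewrite -[u]fK; split.
  by rewrite path_map; apply: sub_path up.
by rewrite last_map lp fK.
Qed.

Lemma induced_walk {D : digraph} {S : {set D}} {u v : induced S} {p} :
  walk u v p -> walk (val u) (val v) (map val p).
Proof.
by case=> up lp; split; rewrite ?last_map ?lp // path_map; apply: sub_path up.
Qed.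

Lemma strong_in_dominating_walk (D : digraph) (S : {set D}) (u v : D) :
  strong_in_dominating S -> v \in S -> exists p, walk u v p.
Proof.
move=> [domS /strongP strS] vS.
have inS z : z \in S -> exists p, walk z v p.
  move=> zS; have [p /induced_walk wp] := strS (exist _ z zS) (exist _ v vS).
  by exists (map val p).
have [/inS //|/domS [z /inS [p [zp lp]] uz]] := boolP (u \in S).
by exists (z :: p); split=> //=; rewrite uz.
Qed.

Theorem theorem3 (D : digraph) :
  (exists P : {set {set D}}, strong_in_domatic_partition P) <-> strong D.
Proof.
split=> [[P [/and3P [/eqP covP _ _] domP]] | sD].
  apply/strongP => u v; have: v \in cover P by rewrite covP inE.
  (* [S] is the block of the target [v], since domination gives arcs into a block. *)
  by case/bigcupP=> S /domP; exact: strong_in_dominating_walk.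
(* The one-block partition is [set0] when [D] has no vertex. *)
exists ([set [set: D]] :\ set0); split.
  rewrite /partition !inE eqxx /= andbT; apply/andP; split.
    rewrite eqEsubset subsetT; apply/subsetP => x _; apply/bigcupP.
    by exists [set: D]; rewrite ?inE // eqxx andbT; apply/set0Pn; exists x.
  (* Two distinct blocks cannot exist: both would equal [[set: D]]. *)
  apply/trivIsetP => A B.
  by rewrite !inE => /andP [_ /eqP->] /andP [_ /eqP->] /eqP.
move=> S /setD1P [_ /set1P ->]; split; first by move=> x; rewrite inE.
exact: strong_induced_setT.
Qed.
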